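(* Let $X$ be an S-separable Tychonoff space and let $Y$ be a Tychonoff space. (1) If there is an open continuous surjection $f:X\to Y$, then $Y$ is S-separable. (2) If there is a closed irreducible (continuous) surjection $f:X\to Y$, then $Y$ is S-separable.
   Context: A space $X$ is S-separable if for every sequence $(Y_n)_{n\in\mathbb{N}}$ of dense subspaces of $X$ there exists a sequence $(F_n)_{n\in\mathbb{N}}$ such that each $F_n$ is a finite subset of $Y_n$ and for each finite collection $\mathcal{F}$ of nonempty open sets of $X$ there exists $n\in\mathbb{N}$ with $U\cap F_n\neq\emptyset$ for all $U\in\mathcal{F}$. A continuous mapping $f:X\to Y$ is irreducible if the only closed subset $C$ of $X$ satisfying $f(C)=Y$ is $C=X$. A mapping is open (closed) if it maps open (closed) sets to open (closed) sets. *)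

(* Defs.v *)
From HB Require Import structures.
From mathcomp Require Import all_boot all_order all_algebra.
From mathcomp Require Import all_classical all_reals all_analysis.

Set Implicit Arguments.
Unset Strict Implicit.
Unset Printing Implicit Defensive.

Local Open Scope classical_set_scope.

(* Completely regular and Hausdorff. The library's [completely_regular_space]
   asks for a coarser uniformity separating a point from a closed set; by the
   library's Urysohn function this yields the usual continuous map to [0, 1]. *)
Definition tychonoff_space (X : topologicalType) : Prop :=
  completely_regular_space X /\ hausdorff_space X.

(* Dense subspaces are represented by their underlying sets. *)
Definition S_separable (X : topologicalType) : Prop :=
  forall Y : nat -> set X, (forall n, dense (Y n)) ->
  exists F : nat -> set X,
    (forall n, finite_set (F n) /\ F n `<=` Y n) /\
    forall G : set (set X), finite_set G ->
      (forall U, G U -> open U /\ U !=set0) ->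
      exists n, forall U, G U -> U `&` F n !=set0.

Definition open_map (X Y : topologicalType) (f : X -> Y) : Prop :=
  forall U : set X, open U -> open (f @` U).

Definition closed_map (X Y : topologicalType) (f : X -> Y) : Prop :=
  forall C : set X, closed C -> closed (f @` C).

Definition irreducible_map (X Y : topologicalType) (f : X -> Y) : Prop :=
  continuous f /\
  forall C : set X, closed C -> f @` C = [set: Y] -> C = [set: X].

(* Main.v *)
(** Both kinds of map pull dense sets back to dense sets. Given such a continuous surjection, pull the
    dense sequence back to [X], select finite sets there and push them forward. *)
Require Import Defs.
From HB Require Import structures.
From mathcomp Require Import all_boot all_order all_algebra.
From mathcomp Require Import all_classical all_reals all_analysis.

Local Open Scope classical_set_scope.

(** If [F n] meets the preimage of [U], then its image meets [U]; so [S_separable_image] needs only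
    density of preimages. For that, each nonempty open [U] of [X] yields a nonempty open set of [Y]
    whose points all have a preimage in [U]: the image of [U] when [f] is open, the complement of
    [f @] ~[U] when [f] is closed and irreducible. *)

Lemma S_separable_image (X Y : topologicalType) (f : X -> Y) :
  continuous f -> set_surj [set: X] [set: Y] f ->
  (forall D : set Y, dense D -> dense (f @^-1` D)) ->
  S_separable X -> S_separable Y.
Proof.
move=> cf sf df sepX D dD.
have [F [FD FG]] := sepX (fun n => f @^-1` D n) (fun n => df _ (dD n)).
exists (fun n => f @` F n); split=> [n|G finG oG].
  have [finF FDn] := FD n; split; first exact: finite_image.
  by move=> _ [x Fx <-]; exact: FDn.
(* Continuity makes these preimages open, surjectivity makes them nonempty. *)
have [|_ [U GU <-]|n nG] := FG ((fun U => f @^-1` U) @` G).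
- exact: finite_image.
- have [oU [y Uy]] := oG _ GU; split.
    by apply: open_comp => // x _; exact: cf.
  by have [x _ fxy] := sf y I; exists x; rewrite /= fxy.
exists n => U GU; have [|x [Ufx Fx]] := nG (f @^-1` U); first by exists U.
by exists (f x); split=> //; exists x.
Qed.

Lemma open_map_dense_preimage (X Y : topologicalType) (f : X -> Y) (D : set Y) :
  open_map f -> dense D -> dense (f @^-1` D).
Proof.
move=> of_ dD U [x Ux] oU.
have [|_ [[z Uz <-] Dz]] := dD (f @` U) _ (of_ _ oU); first by exists (f x), x.
by exists z.
Qed.

Lemma irreducible_closed_map_dense_preimage (X Y : topologicalType)
    (f : X -> Y) (D : set Y) :
  closed_map f -> irreducible_map f -> set_surj [set: X] [set: Y] f ->
  dense D -> dense (f @^-1` D).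
Proof.
move=> clf [_ irrf] sf dD U [x Ux] oU.
have clU : closed (~` U) by exact: open_closedC.
have [||y [nfy Dy]] := dD (~` (f @` ~` U)).
- apply/set0P/eqP; rewrite -setCT => /setC_inj /(irrf _ clU) UT.
  by have : (~` U) x by rewrite UT.
- by apply: closed_openC; exact: clf.
(* Any preimage of [y] lies in [U], as [y] is not in [f @] ~[U]. *)
have [z _ fzy] := sf y I; exists z; split; last by rewrite /= fzy.
by apply: contrapT => nUz; apply: nfy; exists z.
Qed.

Theorem proposition3p8 (X Y : topologicalType)
    (tychX : tychonoff_space X) (sepX : S_separable X)
    (tychY : tychonoff_space Y) :
  ((exists f : X -> Y,
      [/\ open_map f, continuous f & set_surj [set: X] [set: Y] f]) ->
    S_separable Y) /\
  ((exists f : X -> Y,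
      [/\ closed_map f, irreducible_map f & set_surj [set: X] [set: Y] f]) ->
    S_separable Y).
Proof.
split=> -[f [mf cf sf]].
  apply: (@S_separable_image X Y f) => // D; exact: open_map_dense_preimage.
apply: (@S_separable_image X Y f) => //; first by case: cf.
by move=> D; exact: irreducible_closed_map_dense_preimage.
Qed.
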